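(* There exist positive numbers $(w_n)_{n=0}^\infty$ with $\liminf_n w_n =0$ such that any non-trivial (i.e. non-zero) complex finite Borel measure $\mu$ on $\mathbb{T}$ with $\sum_{n\in\mathbb{Z}}|\widehat{\mu}(n)|^2 w_{|n|}<\infty$ has full support, i.e. $\operatorname{supp}(\mu)=\mathbb{T}$.
   Context: $\mathbb{T}$ is the unit circle, and $\widehat{\mu}(n)=\int_{\mathbb{T}}\zeta^{-n}\,d\mu(\zeta)$, $n\in\mathbb{Z}$, denotes the $n$-th Fourier coefficient of $\mu$. *)

(* Defs.v *)
From HB Require Import structures.
From mathcomp Require Import all_boot all_order all_algebra.
From mathcomp Require Import complex.
From mathcomp Require Import all_classical all_reals all_analysis.

Set Implicit Arguments.
Unset Strict Implicit.
Unset Printing Implicit Defensive.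

Import Order.TTheory GRing.Theory Num.Theory.
Import numFieldNormedType.Exports.

Local Open Scope classical_set_scope.
Local Open Scope ring_scope.
Local Open Scope complex_scope.

(* R[i]^o is R[i] with its usual (norm) topology. *)
Definition unit_circle (R : realType) : set R[i]^o :=
  [set z | `|z : R[i]| = 1].

Definition circle (R : realType) : Type := set_type (@unit_circle R).
HB.instance Definition _ (R : realType) := Topological.on (circle R).

Definition circle_val (R : realType) (z : circle R) : R[i] := \val z.

Lemma unit_circle1 (R : realType) : (1 : R[i]^o) \in @unit_circle R.
Proof. by rewrite inE /unit_circle /= normr1. Qed.

HB.instance Definition _ (R : realType) :=
  isPointed.Build (circle R)
    (exist (fun z => z \in @unit_circle R) _ (unit_circle1 R)).

Definition borel_circle (R : realType) :=
  g_sigma_algebraType (@open (circle R)).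

Section complex_measure.
Context d (T : measurableType d) (R : realType).

(* Finiteness is automatic, as the values are complex numbers, and
   mu set0 = 0 follows by taking F constantly equal to set0. *)
Definition complex_sigma_additive (mu : set T -> R[i]) :=
  forall F : (set T)^nat, (forall i, measurable (F i)) -> trivIset setT F ->
  (fun n => \sum_(0 <= i < n) mu (F i) : R[i]^o) @ \oo
    --> (mu (\bigcup_i F i) : R[i]^o).

Record complex_measure := ComplexMeasure {
  complex_measure_fun :> set T -> R[i] ;
  complex_measureP : complex_sigma_additive complex_measure_fun }.

End complex_measure.

Section re_im_parts.
Context d (T : measurableType d) (R : realType).
Variable mu : complex_measure T R.

Lemma complex_measure0 : mu set0 = 0.
Proof.
have := @complex_measureP _ _ _ mu (fun=> set0) (fun=> measurable0)
  (@trivIset_set0 _ _ _).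
rewrite bigcup0// => /cvgrPdist_lt h.
apply/eqP; rewrite -normr_eq0; apply/negPn/negP => mu0_neq0.
have mu0_gt0 : (0 : R[i]^o) < `|mu set0 : R[i]^o|.
  by rewrite lt_neqAle eq_sym mu0_neq0/=.
have [N _ /(_ N.+2 (leqW (leqnSn N)))] := h _ mu0_gt0.
rewrite /= sumr_const_nat subn0 distrC mulrSr addrK normrMn mulrSr.
by rewrite le_gtF ?lerDr ?mulrn_wge0.
Qed.

Definition re_measure (A : set T) : \bar R := (complex.Re (mu A))%:E.
Definition im_measure (A : set T) : \bar R := (complex.Im (mu A))%:E.

Let sigma_additive_part (p : {additive R[i] -> R}) :
  (forall z : R[i], `|p z|%:C <= `|z|) ->
  semi_sigma_additive (fun A => (p (mu A))%:E).
Proof.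
move=> ple F mF tF _.
rewrite (_ : (fun _ => _) =
    EFin \o (fun n => p (\sum_(0 <= i < n) mu (F i)))); last first.
  by apply/funext => n /=; rewrite raddf_sum sumEFin.
apply: cvg_EFin; first by near=> n.
have /cvgrPdist_lt h := @complex_measureP _ _ _ mu F mF tF.
apply/cvgrPdist_lt => e e0.
have e0' : (0 : R[i]^o) < e%:C by rewrite ltcR.
have := h _ e0'; apply: filterS => n /=.
rewrite -ltcR -raddfB; exact: le_lt_trans.
Unshelve. all: by end_near. Qed.

Let re_measure0 : re_measure set0 = 0%E.
Proof. by rewrite /re_measure complex_measure0. Qed.

Let re_measure_finite A : measurable A -> re_measure A \is a fin_num.
Proof. by []. Qed.

Let re_measure_sigma_additive : semi_sigma_additive re_measure.
Proof.
apply: (sigma_additive_part (p := @complex.Re R)) => z.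
exact: normc_ge_Re.
Qed.

HB.instance Definition _ := isCharge.Build _ T R re_measure
  re_measure0 re_measure_finite re_measure_sigma_additive.

Let im_measure0 : im_measure set0 = 0%E.
Proof. by rewrite /im_measure complex_measure0. Qed.

Let im_measure_finite A : measurable A -> im_measure A \is a fin_num.
Proof. by []. Qed.

Let im_measure_sigma_additive : semi_sigma_additive im_measure.
Proof.
apply: (sigma_additive_part (p := @complex.Im R)) => -[a b].
rewrite normc_def lecR /= -sqrtr_sqr ler_wsqrtr// lerDr; exact: sqr_ge0.
Qed.

HB.instance Definition _ := isCharge.Build _ T R im_measure
  im_measure0 im_measure_finite im_measure_sigma_additive.

End re_im_parts.

Section integral.
Context d (T : measurableType d) (R : realType).

Implicit Type nu : {charge set T -> \bar R}.

Definition hahn_pos nu : set T := sval (cid (Hahn_decomposition nu)).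
Definition hahn_neg nu : set T :=
  sval (cid (svalP (cid (Hahn_decomposition nu)))).

Lemma hahn_pos_neg nu : hahn_decomposition nu (hahn_pos nu) (hahn_neg nu).
Proof. exact: svalP (cid (svalP (cid (Hahn_decomposition nu)))). Qed.

(* By uniqueness up to null sets, the value does not depend on the Hahn
   decomposition chosen above. *)
Definition charge_integral nu (f : T -> R) : R :=
  \int[jordan_pos (hahn_pos_neg nu)]_x f x -
  \int[jordan_neg (hahn_pos_neg nu)]_x f x.

Definition complex_integral (mu : complex_measure T R) (f : T -> R[i]) : R[i] :=
  let u x := complex.Re (f x) in
  let v x := complex.Im (f x) in
  (charge_integral (re_measure mu) u - charge_integral (im_measure mu) v) +i*
  (charge_integral (re_measure mu) v + charge_integral (im_measure mu) u).

Definition complex_variation (mu : complex_measure T R) (A : set T) : \bar R :=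
  ereal_sup [set s | exists F : (set T)^nat,
    [/\ forall i, measurable (F i), trivIset setT F, \bigcup_i F i = A
      & s = (\sum_(0 <= i <oo) (Normc.normc (mu (F i)))%:E)%E]].

End integral.

Definition fourier_coef (R : realType)
    (mu : complex_measure (borel_circle R) R) (n : int) : R[i] :=
  complex_integral mu (fun z : circle R => circle_val z ^ (- n)).

Definition measure_support (R : realType) (mu : complex_measure (borel_circle R) R) :
    set (circle R) :=
  [set z | forall U : set (circle R),
    open U -> U z -> (0 < complex_variation mu U)%E].

(* Main.v *)
(* The weight is huge except at a very sparse sequence [N_0 < N_1 < ...] along
   which it tends to [0]. For each [k] there is an analytic polynomial
   [P_k = 1 + O(z^(2 N_k + 1))] which is at most [1/(k+1)] on the circle outside
   the disc of radius [1/(k+1)] about [1]: take [P_k = 1 - (1 - G)^(2 N_k + 1)]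
   where [G(0) = 1] and [G] is tiny outside that disc. The next exceptional index
   [N_(k+1)] is chosen beyond [2 N_k + deg P_k], and the weight between [N_k] and
   [N_(k+1)] is chosen large with respect to the coefficients of [P_k].
   If [mu] vanishes near a point [z0] of the circle, then the integral of
   [z^-m P_k(z / z0)] is [O(1/k)]. By weighted summability it is also the [m]-th
   Fourier coefficient up to [O(1/k)], because the other frequencies occurring in
   it have absolute value strictly between [N_k] and [N_(k+1)]. Hence all Fourier
   coefficients vanish and [mu = 0]. *)
Require Import Defs.
From HB Require Import structures.
From mathcomp Require Import all_boot all_order all_algebra.
From mathcomp Require Import complex.
From mathcomp Require Import all_classical all_reals all_analysis.
From mathcomp Require Import measurable_realfun.
From mathcomp Require Import ring lra zify.

Set Implicit Arguments.
Unset Strict Implicit.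
Unset Printing Implicit Defensive.

Import Order.TTheory GRing.Theory Num.Theory.
Import numFieldNormedType.Exports.

Local Open Scope classical_set_scope.
Local Open Scope ring_scope.
Local Open Scope complex_scope.

(** * Integration against complex measures *)

Section charge_integral.
Context d (T : measurableType d) (R : realType).
Implicit Types (f g : T -> R) (nu : {charge set T -> \bar R}).

Definition bounded_measurable f :=
  measurable_fun setT f /\ exists M, forall x, `|f x| <= M.

Lemma bounded_measurable_integrable (mu : {finite_measure set T -> \bar R}) f :
  bounded_measurable f -> mu.-integrable setT (EFin \o f).
Proof.
move=> [mf [M fM]]; apply: measurable_bounded_integrable => //.
  by rewrite ltey_eq fin_num_measure.
exists M; split; first exact: num_real.
by move=> y My x _ /=; rewrite (le_trans (fM x))// ltW.
Qed.

Lemma bounded_measurableD f g : bounded_measurable f -> bounded_measurable g ->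
  bounded_measurable (fun x => f x + g x).
Proof.
move=> [mf [M fM]] [mg [N gN]]; split; first exact: measurable_funD.
by exists (M + N) => x; rewrite (le_trans (ler_normD _ _))// lerD.
Qed.

Lemma bounded_measurableZ r f : bounded_measurable f ->
  bounded_measurable (fun x => r * f x).
Proof.
move=> [mf [M fM]]; split.
  by apply: measurable_funM => //; exact: measurable_cst.
by exists (`|r| * M) => x; rewrite normrM ler_wpM2l.
Qed.

Lemma charge_integralD nu f g :
  bounded_measurable f -> bounded_measurable g ->
  charge_integral nu (fun x => f x + g x) =
  charge_integral nu f + charge_integral nu g.
Proof.
move=> bf bg; rewrite /charge_integral.
by rewrite !RintegralD//; try (exact: bounded_measurable_integrable); ring.
Qed.

Lemma charge_integralZ nu r f : bounded_measurable f ->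
  charge_integral nu (fun x => r * f x) = r * charge_integral nu f.
Proof.
move=> bf; rewrite /charge_integral.
by rewrite !RintegralZl//; try (exact: bounded_measurable_integrable); ring.
Qed.

Lemma charge_integral_indic nu (A : set T) : measurable A ->
  charge_integral nu \1_A = fine (nu A).
Proof.
move=> mA; rewrite /charge_integral /Rintegral !integral_indic// setIT.
rewrite [in RHS](jordan_decomp (hahn_pos_neg nu))// /cadd/= cscaleN1 fineD//.
- by rewrite fineN.
- exact: fin_num_measure.
- by rewrite fin_numN; exact: fin_num_measure.
Qed.

Let Rintegral_le (mu : {finite_measure set T -> \bar R}) (U : set T) f (M : R) :
  measurable U -> mu U = 0%E -> bounded_measurable f -> 0 <= M ->
  (forall x, ~ U x -> `|f x| <= M) ->
  `|\int[mu]_x f x| <= fine (mu setT) * M.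
Proof.
move=> mU U0 bf M0 fM.
have intf := bounded_measurable_integrable mu bf.
have intfU A : measurable A -> mu.-integrable A (EFin \o f).
  by move=> mA; apply: integrableS intf.
rewrite -(setUv U) Rintegral_setU//; first last.
- by apply/disj_setPS => x [].
- by rewrite setUv.
- exact: measurableC.
rewrite {1}/Rintegral null_set_integral//;
  last exact: measurable_int (intfU _ mU).
rewrite add0r (le_trans (le_normr_Rintegral _ _))//.
- exact: measurableC.
- by apply: intfU; exact: measurableC.
have mUc := measurableC mU.
rewrite (@le_trans _ _ (\int[mu]_(x in ~` U) M))//.
  apply: le_Rintegral => //.
  - exact: (integrable_norm (intfU _ mUc)).
  - exact: finite_measure_integrable_cst.
rewrite Rintegral_cst// mulrC ler_wpM2r//.
rewrite setUv fine_le ?fin_num_measure//.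
by rewrite le_measure// inE.
Qed.

(** [K] is the total mass of the two Jordan parts. Both parts are null on [U], so only the
    complement contributes. That [K] does not depend on [f] matters later, when the integrand varies
    with the index of the peak polynomial. *)
Lemma charge_integral_le nu : exists2 K, 0 <= K &
  forall (U : set T) f (M : R), measurable U ->
    (forall A, measurable A -> A `<=` U -> nu A = 0%E) ->
    bounded_measurable f -> 0 <= M -> (forall x, ~ U x -> `|f x| <= M) ->
  `|charge_integral nu f| <= K * M.
Proof.
set p := jordan_pos (hahn_pos_neg nu); set n := jordan_neg (hahn_pos_neg nu).
exists (fine (p setT) + fine (n setT)).
  by rewrite addr_ge0// fine_ge0// measure_ge0.
move=> U f M mU U0 bf M0 fM.
have [[mP _] [mN _] _ _] := hahn_pos_neg nu.
rewrite /charge_integral (le_trans (ler_normB _ _))// mulrDl lerD//.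
- apply: (@Rintegral_le _ U) => //.
  (* Unfolded, the positive part of [U] is the charge of [U] intersected with the positive Hahn set,
     a measurable subset of [U]. The negative part is treated likewise, up to a sign. *)
  change (crestr0 nu mP U = 0%E); rewrite /crestr0 mem_set// /crestr U0//.
  exact: measurableI.
- apply: (@Rintegral_le _ U) => //.
  change (((-1)%:E * crestr0 nu mN U)%E = 0%E).
  rewrite /crestr0 mem_set// /crestr U0 ?mule0//.
  exact: measurableI.
Qed.

Let Rintegral_cvg (mu : {finite_measure set T -> \bar R})
    (f_ : (T -> R)^nat) f (M : R) :
  (forall n, measurable_fun setT (f_ n)) -> (forall n x, `|f_ n x| <= M) ->
  (forall x, f_ ^~ x @ \oo --> f x) ->
  (fun n => \int[mu]_x f_ n x) @ \oo --> \int[mu]_x f x.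
Proof.
move=> mf fM ff; apply: fine_cvg.
have intM : mu.-integrable setT (EFin \o cst M).
  exact: finite_measure_integrable_cst.
have cf x : setT x -> EFin (f_ n x) @[n --> \oo] --> EFin (f x).
  by move=> _; apply: cvg_EFin; [near=> n|exact: ff].
have mf' n : measurable_fun setT (fun x => (f_ n x)%:E).
  exact/measurable_EFinP.
have fM' n x : setT x -> (`|(EFin \o f_ n) x| <= (EFin \o cst M) x)%E.
  by move=> _; rewrite lee_fin.
have mf0 : measurable_fun setT (fun x => (f x)%:E).
  exact: (emeasurable_fun_cvg _ _ mf' cf).
have [||intf _] :=
  dominated_convergence (mu := mu) measurableT mf' mf0 _ intM _.
- exact: aeW.
- by apply: aeW => x n; exact: fM'.
by rewrite fineK//; exact: integrable_fin_num.
Unshelve. all: by end_near. Qed.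

Lemma charge_integral_cvg nu (f_ : (T -> R)^nat) f (M : R) :
  (forall n, measurable_fun setT (f_ n)) -> (forall n x, `|f_ n x| <= M) ->
  (forall x, f_ ^~ x @ \oo --> f x) ->
  (fun n => charge_integral nu (f_ n)) @ \oo --> charge_integral nu f.
Proof. by move=> mf fM ff; apply: cvgB; exact: (Rintegral_cvg (M := M)). Qed.

End charge_integral.

Section normc.
Context (R : realType).
Import Normc.
Implicit Types z : R[i].

Lemma normr_Re_le z : `|complex.Re z| <= normc z.
Proof. by rewrite -lecR; exact: normc_ge_Re. Qed.

Lemma normr_Im_le z : `|complex.Im z| <= normc z.
Proof.
by case: z => a b /=; rewrite -sqrtr_sqr ler_wsqrtr// lerDr sqr_ge0.
Qed.

Lemma normc_le_ReIm z : normc z <= `|complex.Re z| + `|complex.Im z|.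
Proof.
case: z => a b /=; rewrite -[leRHS]ger0_norm ?addr_ge0// -sqrtr_sqr.
rewrite ler_wsqrtr// sqrrD !real_normK ?num_real//.
by rewrite addrAC lerDl mulrn_wge0// mulr_ge0.
Qed.

Lemma normc_ge0 z : 0 <= normc z.
Proof. by case: z => a b /=; exact: sqrtr_ge0. Qed.

Lemma normcX z n : normc (z ^+ n) = normc z ^+ n.
Proof. by elim: n => [|n ih]; rewrite ?expr0 ?normc1// !exprS normcM ih. Qed.

Lemma normc_sum (I : Type) (s : seq I) (P : pred I) (F : I -> R[i]) :
  normc (\sum_(i <- s | P i) F i) <= \sum_(i <- s | P i) normc (F i).
Proof.
apply: (big_ind2 (fun z r => normc z <= r)) => //; first by rewrite normc0.
by move=> z r z' r' zr zr'; rewrite (le_trans (le_normcD _ _))// lerD.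
Qed.

End normc.

Section complex_integral.
Context d (T : measurableType d) (R : realType) (mu : complex_measure T R).
Import Normc.
Implicit Types (f g : T -> R[i]) (u : T -> R).

Definition cbounded_measurable f :=
  bounded_measurable (fun x => complex.Re (f x)) /\
  bounded_measurable (fun x => complex.Im (f x)).

Lemma bounded_measurable_cst (r : R) : bounded_measurable (fun _ : T => r).
Proof. by split; [exact: measurable_cst|exists `|r|]. Qed.

Lemma bounded_measurable_indic (A : set T) : measurable A ->
  bounded_measurable (\1_A : T -> R).
Proof.
move=> mA; split; first exact: measurable_indic.
by exists 1 => x; rewrite indicE; case: (_ \in _); rewrite ?normr1 ?normr0.
Qed.

Lemma bounded_measurableM u v : bounded_measurable u -> bounded_measurable v ->
  bounded_measurable (fun x : T => u x * v x).
Proof.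
move=> [mu_ [M uM]] [mv [N vN]]; split; first exact: measurable_funM.
by exists (M * N) => x; rewrite normrM ler_pM.
Qed.

Lemma cbounded_measurable_real u : bounded_measurable u ->
  cbounded_measurable (fun x => (u x)%:C).
Proof. by move=> bu; split => //; exact: bounded_measurable_cst. Qed.

Lemma cbounded_measurable_cst z : cbounded_measurable (fun=> z).
Proof. by split; exact: bounded_measurable_cst. Qed.

Lemma cbounded_measurableD f g :
  cbounded_measurable f -> cbounded_measurable g ->
  cbounded_measurable (fun x => f x + g x).
Proof.
move=> [rf jf] [rg jg]; split.
- under eq_fun do rewrite raddfD/=; exact: bounded_measurableD.
- under eq_fun do rewrite raddfD/=; exact: bounded_measurableD.
Qed.

Let ReM (z w : R[i]) : complex.Re (z * w) =
  complex.Re z * complex.Re w + -1 * (complex.Im z * complex.Im w).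
Proof. by case: z w => [a b] [c e] /=; ring. Qed.

Let ImM (z w : R[i]) : complex.Im (z * w) =
  complex.Re z * complex.Im w + complex.Im z * complex.Re w.
Proof. by case: z w => [a b] [c e] /=; ring. Qed.

Lemma cbounded_measurableM f g :
  cbounded_measurable f -> cbounded_measurable g ->
  cbounded_measurable (fun x => f x * g x).
Proof.
move=> [rf jf] [rg jg]; split.
- under eq_fun do rewrite ReM; apply: bounded_measurableD.
    exact: bounded_measurableM.
  by apply: bounded_measurableZ; exact: bounded_measurableM.
- under eq_fun do rewrite ImM.
  by apply: bounded_measurableD; exact: bounded_measurableM.
Qed.

Lemma complex_integralD f g :
  cbounded_measurable f -> cbounded_measurable g ->
  complex_integral mu (fun x => f x + g x) =
  complex_integral mu f + complex_integral mu g.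
Proof.
move=> [rf jf] [rg jg]; rewrite /complex_integral.
have -> : (fun x => complex.Re (f x + g x)) =
    (fun x => complex.Re (f x) + complex.Re (g x)).
  by apply/funext => x; rewrite raddfD.
have -> : (fun x => complex.Im (f x + g x)) =
    (fun x => complex.Im (f x) + complex.Im (g x)).
  by apply/funext => x; rewrite raddfD.
by rewrite !charge_integralD//; congr (_ +i* _); ring.
Qed.

Lemma complex_integralZ z f : cbounded_measurable f ->
  complex_integral mu (fun x => z * f x) = z * complex_integral mu f.
Proof.
move=> [rf jf]; rewrite /complex_integral.
have -> : (fun x => complex.Re (z * f x)) = (fun x =>
    complex.Re z * complex.Re (f x) + -1 * (complex.Im z * complex.Im (f x))).
  by apply/funext => x; rewrite ReM.
have -> : (fun x => complex.Im (z * f x)) = (fun x =>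
    complex.Re z * complex.Im (f x) + complex.Im z * complex.Re (f x)).
  by apply/funext => x; rewrite ImM.
rewrite !charge_integralD ?charge_integralZ//;
  try by do ?apply: bounded_measurableZ.
by case: z => a b /=; congr (_ +i* _) => /=; ring.
Qed.

Lemma cbounded_measurable_sum n (c : nat -> R[i]) (f : nat -> T -> R[i]) :
  (forall i, cbounded_measurable (f i)) ->
  cbounded_measurable (fun x => \sum_(i < n) c i * f i x).
Proof.
move=> bf; elim: n => [|n ih].
  by under eq_fun do rewrite big_ord0; exact: cbounded_measurable_cst.
under eq_fun do rewrite big_ord_recr/=; apply: cbounded_measurableD => //.
by apply: cbounded_measurableM => //; exact: cbounded_measurable_cst.
Qed.

Lemma complex_integral_sum n (c : nat -> R[i]) (f : nat -> T -> R[i]) :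
  (forall i, cbounded_measurable (f i)) ->
  complex_integral mu (fun x => \sum_(i < n) c i * f i x) =
  \sum_(i < n) c i * complex_integral mu (f i).
Proof.
move=> bf; elim: n => [|n ih].
  under eq_fun do rewrite big_ord0.
  rewrite big_ord0; have := complex_integralZ 0 (cbounded_measurable_cst 0).
  by under eq_fun do rewrite mul0r; rewrite mul0r.
under eq_fun do rewrite big_ord_recr/=.
rewrite big_ord_recr/= -ih complex_integralD ?complex_integralZ//.
- exact: cbounded_measurable_sum.
- by apply: cbounded_measurableM => //; exact: cbounded_measurable_cst.
Qed.

Lemma complex_integral_le : exists2 K, 0 <= K &
  forall (U : set T) f (M : R), measurable U ->
    (forall A, measurable A -> A `<=` U -> mu A = 0) ->
    cbounded_measurable f -> 0 <= M -> (forall x, ~ U x -> normc (f x) <= M) ->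
  normc (complex_integral mu f) <= K * M.
Proof.
have [K1 K10 H1] := charge_integral_le (re_measure mu).
have [K2 K20 H2] := charge_integral_le (im_measure mu).
exists (K1 + K2 + (K1 + K2)); first by rewrite !addr_ge0.
move=> U f M mU U0 [rf jf] M0 fM.
have rU0 A : measurable A -> A `<=` U -> re_measure mu A = 0%E.
  by move=> mA AU; rewrite /re_measure U0.
have iU0 A : measurable A -> A `<=` U -> im_measure mu A = 0%E.
  by move=> mA AU; rewrite /im_measure U0.
have rM x : ~ U x -> `|complex.Re (f x)| <= M.
  by move=> Ux; rewrite (le_trans (normr_Re_le _))// fM.
have jM x : ~ U x -> `|complex.Im (f x)| <= M.
  by move=> Ux; rewrite (le_trans (normr_Im_le _))// fM.
rewrite (le_trans (normc_le_ReIm _))// /complex_integral/= mulrDl.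
rewrite lerD//; rewrite mulrDl.
- by rewrite (le_trans (ler_normB _ _))// lerD//; [apply: H1 rM|apply: H2 jM].
- by rewrite (le_trans (ler_normD _ _))// lerD//; [apply: H1 jM|apply: H2 rM].
Qed.

Lemma complex_integral_real u : bounded_measurable u ->
  complex_integral mu (fun x => (u x)%:C) =
  charge_integral (re_measure mu) u +i* charge_integral (im_measure mu) u.
Proof.
move=> bu; rewrite /complex_integral/=.
have ci0 (nu : {charge set T -> \bar R}) : charge_integral nu (fun=> 0 : R) = 0.
  have := charge_integralZ nu 0 (bounded_measurable_cst 0).
  by under eq_fun do rewrite mul0r; rewrite mul0r.
by rewrite !ci0 subr0 add0r.
Qed.

(** This carries vanishing integrals from trigonometric polynomials to indicator functions. It is
    bounded convergence, applied separately to the real and imaginary parts of [mu]. *)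
Lemma complex_integral_real_cvg0 (u_ : (T -> R)^nat) u (M : R) :
  (forall n, measurable_fun setT (u_ n)) -> (forall n x, `|u_ n x| <= M) ->
  (forall n, complex_integral mu (fun x => (u_ n x)%:C) = 0) ->
  (forall x, u_ ^~ x @ \oo --> u x) ->
  complex_integral mu (fun x => (u x)%:C) = 0.
Proof.
move=> mu_ uM I0 cu.
have bu_ n : bounded_measurable (u_ n) by split => //; exists M.
have bu : bounded_measurable u.
  split; first exact: (measurable_fun_cvg mu_ (fun x _ => cu x)).
  exists M => x.
  have cux : `|u_ n x| @[n --> \oo] --> `|u x| by exact: cvg_norm (cu x).
  rewrite -(cvg_lim (@Rhausdorff R) cux); apply: limr_le; first exact: cvgP cux.
  by apply: nearW => n; exact: uM.
have I0' n : charge_integral (re_measure mu) (u_ n) = 0 /\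
    charge_integral (im_measure mu) (u_ n) = 0.
  by have := I0 n; rewrite complex_integral_real// => -[].
rewrite complex_integral_real//.
have cst0 (v : nat -> R) l : v @ \oo --> l -> (forall n, v n = 0) -> l = 0.
  move=> vl v0; apply: (cvg_unique _ vl) => //.
  by rewrite (_ : v = cst 0); [exact: cvg_cst|exact/funext].
rewrite (cst0 _ _ (charge_integral_cvg mu_ uM cu)) => [|n].
  rewrite (cst0 _ _ (charge_integral_cvg mu_ uM cu)) => // n.
  by have [] := I0' n.
by have [] := I0' n.
Qed.

Lemma complex_integral_indic (A : set T) : measurable A ->
  complex_integral mu (fun x => (\1_A x)%:C) = mu A.
Proof.
move=> mA; rewrite complex_integral_real; last exact: bounded_measurable_indic.
rewrite !charge_integral_indic// /re_measure /im_measure/=.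
by case: (mu A).
Qed.

End complex_integral.

(** * Polynomials peaking at 1 *)

Section peak_polynomial.
Context (R : realType).
Import Normc.
Implicit Types (z : R[i]).

Lemma normc_sqr z : normc z ^+ 2 = complex.Re z ^+ 2 + complex.Im z ^+ 2.
Proof. by case: z => a b /=; rewrite sqr_sqrtr// addr_ge0 ?sqr_ge0. Qed.

Lemma normcB z w : normc (z - w) <= normc z + normc w.
Proof. by rewrite (le_trans (le_normcD _ _))// normcN. Qed.

Lemma normc_real (r : R) : normc r%:C = `|r|.
Proof. by rewrite /= expr0n/= addr0 sqrtr_sqr. Qed.

Lemma expr_lt_ex (x e : R) : 0 <= x < 1 -> 0 < e -> exists n, x ^+ n < e.
Proof.
move=> /andP[x0 x1] e0.
have /cvgrPdist_lt/(_ e e0)[N _ /(_ N (leqnn N))] : x ^+ n @[n --> \oo] --> 0.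
  by apply: cvg_expr; rewrite ger0_norm.
by rewrite /= sub0r normrN ger0_norm ?exprn_ge0//; exists N.
Qed.

Lemma normc_sqr_1BM (a : R) z : normc z = 1 ->
  normc (1 - a%:C * z) ^+ 2 = 1 + a ^+ 2 - 2 * a * complex.Re z.
Proof.
move=> z1; have := normc_sqr z; rewrite z1 expr1n normc_sqr.
case: z {z1} => x y /= h.
rewrite [in RHS](_ : a ^+ 2 = a ^+ 2 * (x ^+ 2 + y ^+ 2)).
  by ring.
by rewrite -h mulr1.
Qed.

(* For [a < b], on the unit circle [|1 - a z| < |1 - b z|] means
   [Re z < (a + b) / 2], so [(1 - a z) / (1 - b z)] is small away from [1]; it is
   then enough to truncate the geometric series of [1 / (1 - b z)]. *)
Lemma contracting_poly (r : R) : 0 < r -> r <= 1 ->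
  exists g : {poly R[i]}, exists2 s : R, 0 <= s < 1 &
    g.[0] = 1 /\
    forall z, normc z = 1 -> r <= normc (z - 1) -> normc g.[z] ^+ 2 <= s.
Proof.
move=> r0 r1.
(* Write [u], [v] for the squared moduli of [1 - a z], [1 - b z]. Then
   [v - u = (b - a) (a + b - 2 Re z)], where [b - a = r^2 / 8] and the second factor is at least
   [5 r^2 / 8]. The product is at least [4 c], which explains the value of [c]. *)
pose a : R := 1 - r ^+ 2 / 4; pose b : R := 1 - r ^+ 2 / 8.
pose c : R := 5 * r ^+ 4 / 256.
have r20 : 0 < r ^+ 2 by rewrite exprn_gt0.
have r21 : r ^+ 2 <= 1 by rewrite exprn_ile1// ltW.
have r40 : 0 < r ^+ 4 by rewrite exprn_gt0.
have r41 : r ^+ 4 <= 1 by rewrite exprn_ile1// ltW.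
have c0 : 0 < c by rewrite /c; lra.
have c1 : c < 1 by rewrite /c; lra.
have b0 : 0 <= b by rewrite /b; lra.
have b1 : b < 1 by rewrite /b; lra.
(* The truncation error is chosen so that [(1 + b^N)^2 <= 1 + c], which turns the contraction factor
   [1 - c] into [1 - c^2] and no worse. *)
have [N bN] : exists n, b ^+ n < c / 3.
  by apply: expr_lt_ex; [rewrite b0|rewrite divr_gt0].
have bN0 : 0 <= b ^+ N by rewrite exprn_ge0.
exists ((1 - a%:C *: 'X) * \sum_(i < N) (b%:C *: 'X) ^+ i).
exists (1 - c ^+ 2); first by apply/andP; split; nra.
split.
  rewrite hornerM hornerD hornerN hornerC hornerZ hornerX mulr0 subr0 mul1r.
  rewrite horner_sum; case: N bN bN0 => [|N _ _].
    (* An empty sum would give [g(0) = 0], but [N = 0] would force [1 < c / 3]. *)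
    by rewrite expr0 => ?; exfalso; lra.
  rewrite big_ord_recl/= expr0 hornerC big1 ?addr0// => i _.
  by rewrite horner_exp hornerZ hornerX mulr0 expr0n.
move=> z z1 rz.
have xr : r ^+ 2 <= 2 - 2 * complex.Re z.
  rewrite (@le_trans _ _ (normc (z - 1) ^+ 2))//.
    by rewrite lerXn2r ?nnegrE ?normc_ge0// ltW.
  rewrite -normcN opprB -[X in 1 - X]mul1r (normc_sqr_1BM 1 z1).
  by rewrite expr1n; lra.
have x1 : -1 <= complex.Re z.
  have := normr_Re_le z; rewrite z1 ler_norml => /andP[]//.
rewrite hornerM hornerD hornerN hornerC hornerZ hornerX horner_sum.
under eq_bigr do rewrite horner_exp hornerZ hornerX.
rewrite normcM exprMn (normc_sqr_1BM a z1).
set S := \sum_(i < N) _.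
have bS : (1 - b%:C * z) * S = 1 - (b%:C * z) ^+ N.
  by rewrite -[RHS]opprB subrX1 -[RHS]mulNr opprB.
have /(congr1 (fun t => normc t ^+ 2)) := bS.
rewrite normcM exprMn (normc_sqr_1BM b z1) => vw.
have vw1 : normc (1 - (b%:C * z) ^+ N) ^+ 2 <= (1 + b ^+ N) ^+ 2.
  rewrite lerXn2r ?nnegrE ?normc_ge0 ?addr_ge0//.
  rewrite (le_trans (normcB _ _))// normc1 lerD2l normcX normcM z1 mulr1.
  by rewrite normc_real ger0_norm.
rewrite -vw in vw1.
have S0 : 0 <= normc S ^+ 2 by rewrite sqr_ge0.
set u := 1 + a ^+ 2 - _; set v := 1 + b ^+ 2 - _ in vw1.
(* Since [v <= 4], the additive gap [4 c <= v - u] becomes a multiplicative one. *)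
have uv : u <= (1 - c) * v.
  have r4 : r ^+ 4 = r ^+ 2 * r ^+ 2 by rewrite -exprD.
  have vu : 4 * c <= v - u.
    rewrite /u /v /c /a /b r4.
    by move: (r ^+ 2) (complex.Re z) r20 r21 xr x1 => q x q0 q1 qx x1; nra.
  have v4 : v <= 4.
    have : `|b * complex.Re z| <= 1.
      rewrite normrM mulr_ile1//; first by rewrite ger0_norm// ltW.
      by rewrite -z1 normr_Re_le.
    by rewrite /v -mulrA ler_norml => /andP[bz _]; nra.
  by nra.
rewrite (@le_trans _ _ ((1 - c) * v * normc S ^+ 2))//.
  by rewrite ler_wpM2r.
rewrite -mulrA (@le_trans _ _ ((1 - c) * (1 + b ^+ N) ^+ 2))//.
  by rewrite ler_wpM2l// subr_ge0 ltW.
rewrite (_ : 1 - c ^+ 2 = (1 - c) * (1 + c)); last by ring.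
rewrite ler_wpM2l ?subr_ge0 1?ltW//.
by move: (b ^+ N) bN bN0 => t tc t0; nra.
Qed.

Lemma size_coef0_eq1 (p : {poly R[i]}) : p`_0 = 1 -> size p != 0%N.
Proof.
move=> p0; rewrite size_poly_eq0; apply: contra_eq_neq p0 => ->.
by rewrite coef0 eq_sym oner_eq0.
Qed.

Lemma peak_poly (n : nat) (e : R) : 0 < e ->
  exists P : {poly R[i]}, [/\ P`_0 = 1,
    forall j, (0 < j <= n)%N -> P`_j = 0 &
    forall z, normc z = 1 -> e <= normc (z - 1) -> normc P.[z] <= e].
Proof.
move=> e0.
have [g [s s01 [g0 gs]]] : exists g : {poly R[i]}, exists2 s : R, 0 <= s < 1 &
    g.[0] = 1 /\
    forall z, normc z = 1 -> e <= normc (z - 1) -> normc g.[z] ^+ 2 <= s.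
  (* [contracting_poly] needs a radius at most 1; shrinking the radius only enlarges the set on
     which the bound holds. *)
  have [||g [s s01 [g0 gs]]] := @contracting_poly (Num.min 1 e).
  - by rewrite lt_min ltr01.
  - by rewrite ge_min lexx.
  - exists g, s => //; split => // z z1 ez; apply: gs => //.
    by rewrite ge_min ez orbT.
(* The factor [G] must absorb a geometric sum of [n + 1] terms, each at most [2^(n+1)]. Keeping
   [s^M] below 1 as well is what gives [|1 - G| <= 2]. *)
pose d : R := e / (n.+1%:R * 2 ^+ n.+1).
have D0 : 0 < n.+1%:R * 2 ^+ n.+1 :> R by rewrite mulr_gt0// ?exprn_gt0.
have d0 : 0 < d by rewrite divr_gt0.
have [M] : exists k, s ^+ k < Num.min 1 d.
  by apply: expr_lt_ex => //; rewrite lt_min ltr01.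
rewrite lt_min => /andP[sM1 sMd].
(* The exponent is doubled because [s] bounds the square of the modulus of [g]. *)
pose G := g ^+ (2 * M).
have Gs z : normc z = 1 -> e <= normc (z - 1) -> normc G.[z] <= s ^+ M.
  move=> z1 ez; rewrite /G horner_exp normcX exprM.
  by rewrite lerXn2r ?nnegrE ?sqr_ge0 ?gs//; case/andP: s01.
(* As [G(0) = 1], the polynomial [1 - G] is divisible by ['X], so its power [n + 1] only affects
   degrees above [n]. *)
have /factor_theorem[H GH] : root (1 - G) 0.
  by rewrite /root hornerD hornerN hornerC horner_exp g0 expr1n subrr.
exists (1 - (1 - G) ^+ n.+1); split.
- rewrite GH subr0 exprMn coefD coefN coefMXn coef1/= subr0//.
- move=> j /andP[j0 jn].
  by rewrite GH subr0 exprMn coefD coefN coefMXn coef1 ltnS jn gtn_eqF// subr0.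
- move=> z z1 ez; have Gz := Gs z z1 ez.
  rewrite hornerD hornerN hornerC horner_exp hornerD hornerN hornerC.
  set y := 1 - G.[z].
  have -> : 1 - y ^+ n.+1 = G.[z] * \sum_(i < n.+1) y ^+ i.
    rewrite -[LHS]opprB subrX1 -[LHS]mulNr opprB; congr (_ * _).
    by rewrite /y; ring.
  have y2 : normc y <= 2.
    rewrite (le_trans (normcB _ _))// normc1 -[leRHS]/(1 + 1 : R) lerD2l.
    by rewrite (le_trans Gz)// ltW.
  rewrite normcM (@le_trans _ _ (d * (n.+1%:R * 2 ^+ n.+1)))//; last first.
    by rewrite divfK// gt_eqF.
  rewrite ler_pM ?normc_ge0//; first by rewrite (le_trans Gz)// ltW.
  rewrite (le_trans (normc_sum _ _ _))//.
  rewrite mulr_natl -[X in _ *+ X]card_ord -sumr_const ler_sum// => i _.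
  rewrite normcX (@le_trans _ _ (2 ^+ i))//.
    by rewrite lerXn2r ?nnegrE ?normc_ge0.
  by rewrite ler_weXn2l// ?ler1n// ltnW.
Qed.

End peak_polynomial.

(** * Construction of the sparse indices and of the weight *)

Section sparse_weights.
Context (R : realType).
Import Normc.

Let peak_ex n k := cid (@peak_poly R n k.+1%:R^-1 ltac:(by rewrite invr_gt0)).
Let peak n k : {poly R[i]} := sval (peak_ex n k).

Let N := fix N (k : nat) : nat :=
  if k is k'.+1 then (N k' + N k' + size (peak (N k' + N k') k')).+1 else 0%N.
Let P k := peak (N k + N k) k.

(** Summing over all [k <= n] avoids locating [n] among the [N k]: if [N k < n] then [k <= N k < n],
    so the [k]-th term is present. The square matches the squared moduli in the weighted sum. *)
Let w (n : nat) : R :=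
  if `[< exists k, n = N k >] then n.+1%:R^-1
  else (\sum_(k < n.+1) k.+1%:R * \sum_(i < size (P k)) normc (P k)`_i) ^+ 2.

Let NS k : N k.+1 = (N k + N k + size (P k)).+1.
Proof. by []. Qed.

Let N_homo : {homo N : m n / (m < n)%N}.
Proof. by apply: homo_ltn => [? ? ?|k]; [exact: ltn_trans|rewrite NS; lia]. Qed.

Let N_ge k : (k <= N k)%N.
Proof. by elim: k => // k ih; rewrite NS; lia. Qed.

Let P0 k : (P k)`_0 = 1.
Proof. by rewrite /P /peak; case: (svalP (peak_ex (N k + N k) k)). Qed.

Let B k := \sum_(i < size (P k)) normc (P k)`_i.

Let B_ge1 k : 1 <= B k.
Proof.
rewrite /B; have := size_coef0_eq1 (P0 k).
case: (size (P k)) => // m _; rewrite big_ord_recl/= P0 normc1 lerDl.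
by rewrite sumr_ge0// => i _; exact: normc_ge0.
Qed.

Let wE j : w j = if `[< exists k, j = N k >] then j.+1%:R^-1
  else (\sum_(k < j.+1) k.+1%:R * B k) ^+ 2.
Proof. by []. Qed.

(** The range lies strictly between [N k] and [N k.+1], so it contains no exceptional index, and
    [w j] is the square of a sum of nonnegative terms that includes the [k]-th. *)
Let w_large k j : (N k < j <= N k + size (P k))%N ->
  (k.+1%:R * B k) ^+ 2 <= w j.
Proof.
move=> /andP[kj jk]; rewrite wE; case: asboolP => [[i ji]|_].
  have ki : (k < i)%N.
    rewrite ltnNge; apply/negP => /(ltnW_homo N_homo).
    by rewrite -ji leqNgt kj.
  by have := ltnW_homo N_homo ki; rewrite -ji NS; lia.
have lekj : (k < j.+1)%N by have := N_ge k; lia.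
have kB0 i : 0 <= i.+1%:R * B i by rewrite mulr_ge0// (le_trans _ (B_ge1 i)).
rewrite lerXn2r ?nnegrE ?sumr_ge0//.
rewrite (bigD1 (Ordinal lekj))//= lerDl sumr_ge0//.
Qed.

Let w_gt0 n : 0 < w n.
Proof.
rewrite wE; case: asboolP => _; first by rewrite invr_gt0.
rewrite exprn_gt0// big_ord_recl/= ltr_pwDl//.
  by rewrite mul1r (lt_le_trans ltr01).
by apply: sumr_ge0 => i _; rewrite mulr_ge0// (le_trans _ (B_ge1 _)).
Qed.

Lemma sparse_weights :
  exists (w : nat -> R) (N : nat -> nat) (P : nat -> {poly R[i]}),
  [/\ forall n, 0 < w n,
      limn_einf (fun n => (w n)%:E) = 0%E,
      forall k, (k <= N k)%N &
      forall k, [/\ (P k)`_0 = 1,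
        forall j, (0 < j <= N k + N k)%N -> (P k)`_j = 0,
        forall z, normc z = 1 -> k.+1%:R^-1 <= normc (z - 1) ->
          normc (P k).[z] <= k.+1%:R^-1 &
        forall j, (N k < j <= N k + size (P k))%N ->
          (k.+1%:R * \sum_(i < size (P k)) normc (P k)`_i) ^+ 2 <= w j]].
Proof.
exists w, N, P; split => //.
- rewrite limn_einf_lim (_ : einfs _ = cst 0%E); first exact: lim_cst.
  apply/funext => n; apply/eqP; rewrite eq_le /einfs/=; apply/andP; split.
    apply/lee_addgt0Pr => e e0; rewrite add0e.
    have [m _ /(_ m (leqnn m)) em] := near_infty_natSinv_lt (PosNum e0).
    (* The exceptional index [j] is at least [n], hence in the tail, and at least [m], hence of
       weight below [e]. *)
    have := N_ge (maxn m n); set j := N _ => mnj.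
    apply: (@le_trans _ _ (w j)%:E).
      by apply: ereal_inf_lbound; exists j => //=; lia.
    rewrite lee_fin wE asboolT; last by exists (maxn m n).
    rewrite (le_trans _ (ltW em))//= lef_pV2 ?posrE// ler_nat; lia.
  by apply: le_ereal_inf_tmp => _ [m _ <-]; rewrite lee_fin ltW.
- move=> k; split => //.
  + by rewrite /P /peak; case: (svalP (peak_ex (N k + N k) k)).
  + by rewrite /P /peak; case: (svalP (peak_ex (N k + N k) k)).
  + exact: w_large.
Qed.

End sparse_weights.

(** * Uniqueness of Fourier coefficients *)

Section circle_topology.
Context (R : realType).
Import Normc.
Implicit Types (z : circle R).

Lemma normc_circle z : normc (circle_val z) = 1.
Proof.
have /set_mem := valP z; rewrite /unit_circle/= => z1.
by apply: complexI; rewrite -[LHS]/`|circle_val z| -/(circle_val z) z1.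
Qed.

Lemma circle_open_ball (U : set (circle R)) z : open U -> U z ->
  exists2 e : R, 0 < e &
    forall t, normc (circle_val z - circle_val t) < e -> U t.
Proof.
move=> [V oV <-] /= Vz.
have [e /= e0 zeV] := open_nbhs_nbhs (conj oV Vz).
(* Radii of balls in [R[i]] are elements of [R[i]]; a positive one is real. *)
have ee : e = (complex.Re e)%:C.
  by rewrite RRe_real// ger0_real// ltW.
exists (complex.Re e) => [|t te]; first by rewrite -ltcR -ee.
apply: zeV; rewrite /ball/= ee /circle_val.
by rewrite -ltcR in te.
Qed.

(** Such a [p] is 1-Lipschitz, so preimages of the open intervals, which generate the Borel sets of
    [R], are open in the circle. *)
Lemma measurable_circle_part (p : {additive R[i] -> R}) :
  (forall z : R[i], `|p z| <= normc z) ->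
  measurable_fun setT (fun z : borel_circle R => p (circle_val z)).
Proof.
move=> pn.
have op (A : set R) : open A -> open (p @^-1` A : set R[i]^o).
  move=> oA; rewrite openE => z Az.
  have /nbhs_ballP[e /= e0 eA] := open_nbhs_nbhs (conj oA Az).
  apply/nbhs_ballP; exists e%:C => /=; first by rewrite ltcR.
  move=> t zt; apply: eA.
  rewrite /ball/= -raddfB (le_lt_trans (pn _))// -ltcR; exact: zt.
apply: (measurability _ (RGenOpens.measurableE R)) => _ [_ [a [b ->] <-]].
rewrite setTI; apply: sub_sigma_algebra.
by exists (p @^-1` `]a, b[%classic) => //; exact/op/interval_open.
Qed.

Lemma cbounded_measurable_circle_val :
  cbounded_measurable (@circle_val R : borel_circle R -> R[i]).
Proof.
split; split.
- apply: measurable_circle_part => t.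
  exact: normr_Re_le.
- by exists 1 => z; rewrite (le_trans (normr_Re_le _))// normc_circle.
- apply: measurable_circle_part => t.
  exact: normr_Im_le.
- by exists 1 => z; rewrite (le_trans (normr_Im_le _))// normc_circle.
Qed.

Lemma circle_val_neq0 z : circle_val z != 0.
Proof.
apply: contra_eqN (normc_circle z) => /eqP ->.
by rewrite normc0 eq_sym oner_eq0.
Qed.

Lemma circle_valV z : (circle_val z)^-1 = (circle_val z)^*.
Proof.
have := circle_val_neq0 z; have := normc_circle z.
move: (circle_val z) => t t1 t0.
apply: (mulfI t0); rewrite divff//.
have := normc_sqr t; rewrite t1; case: t {t0 t1} => a b /= h.
apply/eqP; rewrite eq_complex /=; apply/andP; split; apply/eqP.
- by move: h; rewrite expr1n => ->; ring.
- by ring.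
Qed.

Lemma normc_circle_exp z (n : int) : normc (circle_val z ^ n) = 1.
Proof.
case: n => k; first by rewrite -exprnP normcX normc_circle expr1n.
by rewrite NegzE -exprnN normcV normcX normc_circle expr1n invr1.
Qed.

Lemma cbounded_measurable_circle_exp (n : int) :
  cbounded_measurable (fun z : borel_circle R => circle_val z ^ n).
Proof.
have cX (f : borel_circle R -> R[i]) k : cbounded_measurable f ->
    cbounded_measurable (fun z : borel_circle R => f z ^+ k).
  move=> bf; elim: k => [|k ih].
    by under eq_fun do rewrite expr0; exact: cbounded_measurable_cst.
  by under eq_fun do rewrite exprS; exact: cbounded_measurableM.
case: n => k; first exact: (cX (@circle_val R)) cbounded_measurable_circle_val.
have -> : (fun z : borel_circle R => circle_val z ^ Negz k) =
    (fun z : borel_circle R => (circle_val z)^* ^+ k.+1).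
  by apply/funext => z; rewrite NegzE -exprnN -exprVn circle_valV.
apply: (cX (fun z : borel_circle R => (circle_val z)^*)).
have [rv jv] := cbounded_measurable_circle_val; split.
- rewrite (_ : (fun z => _) =
    (fun z : borel_circle R => complex.Re (circle_val z)))//.
  by apply/funext => z; case: (circle_val z).
- rewrite (_ : (fun z => _) =
    (fun z : borel_circle R => -1 * complex.Im (circle_val z))).
    exact: bounded_measurableZ.
  by apply/funext => z; rewrite mulN1r; case: (circle_val z).
Qed.

End circle_topology.

(** * Polynomial iteration converging to the sign function *)

Section sign_iteration.
Context (R : realType).
Implicit Types t : R.

(** An odd polynomial that fixes -1, 0 and 1 and pushes the other points of [-1, 1] towards the
    endpoint of the same sign. Its iterates replace Weierstrass approximation in the uniqueness
    proof. *)
Definition sharpen t : R := (3 * t - t ^+ 3) / 2.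

Let sharpenN t : sharpen (- t) = - sharpen t.
Proof. by rewrite /sharpen; field. Qed.

Let iter_sharpenN n t : iter n sharpen (- t) = - iter n sharpen t.
Proof. by elim: n => //= n ->; rewrite sharpenN. Qed.

Let iter_sharpen0 n : iter n sharpen 0 = 0.
Proof. by elim: n => //= n ->; rewrite /sharpen; field. Qed.

(** The distance to 1 is multiplied by [1 - (x + x^2) / 2] at each step. The iterates increase from
    [t], so this factor is at most [1 - t / 2]. *)
Let iter_sharpen_gt0 n t : 0 < t -> t <= 1 ->
  t <= iter n sharpen t <= 1 /\ 1 - iter n sharpen t <= (1 - t / 2) ^+ n.
Proof.
move=> t0 t1; elim: n => [|n [/andP[tx x1] xn]] /=.
  by rewrite lexx t1 expr0 gerBl (ltW t0).
set x := iter n sharpen t in tx x1 xn *.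
have -> : sharpen x = x + x * (1 - x) * (1 + x) / 2 by rewrite /sharpen; field.
have x0 : 0 < x by exact: lt_le_trans tx.
have s0 : 0 <= x * (1 - x) * (1 + x) / 2.
  by rewrite divr_ge0// !mulr_ge0//; lra.
have e : 1 - (x + x * (1 - x) * (1 + x) / 2) = (1 - x) * (1 - (x + x ^+ 2) / 2).
  by field.
have x2 : 0 <= x ^+ 2 <= 1 by rewrite sqr_ge0 exprn_ile1// ltW.
have [x20 x21] := andP x2.
have e0 : 0 <= 1 - (x + x ^+ 2) / 2 by lra.
split.
  apply/andP; split; first by rewrite (le_trans tx)// lerDl.
  by rewrite -subr_ge0 e mulr_ge0// subr_ge0.
rewrite e [leRHS]exprS [leRHS]mulrC ler_pM// ?subr_ge0//.
lra.
Qed.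

Lemma iter_sharpen_le1 n t : `|t| <= 1 -> `|iter n sharpen t| <= 1.
Proof.
have h s : 0 < s -> s <= 1 -> `|iter n sharpen s| <= 1.
  move=> s0 s1; have [/andP[sx x1] _] := iter_sharpen_gt0 n s0 s1.
  by rewrite ger0_norm// (le_trans (ltW s0)).
have [t0|t0|<-] := ltrgtP 0 t.
- by rewrite gtr0_norm//; exact: h.
- by rewrite ltr0_norm// => t1; rewrite -normrN -iter_sharpenN h// oppr_gt0.
- by rewrite iter_sharpen0.
Qed.

Lemma iter_sharpen_cvg t : `|t| <= 1 ->
  iter n sharpen t @[n --> \oo] --> Num.sg t.
Proof.
have h s : 0 < s -> s <= 1 -> iter n sharpen s @[n --> \oo] --> (1 : R).
  move=> s0 s1; apply/cvgrPdist_lt => e e0.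
  have : (1 - s / 2) ^+ n @[n --> \oo] --> (0 : R).
    by apply: cvg_expr; rewrite ger0_norm; lra.
  move=> /cvgrPdist_lt/(_ e e0); apply: filterS => n.
  rewrite sub0r normrN ger0_norm ?exprn_ge0//; last lra.
  have [/andP[sx x1] xn] := iter_sharpen_gt0 n s0 s1.
  by rewrite ger0_norm ?subr_ge0//; exact: le_lt_trans.
have [t0|t0|<-] := ltrgtP 0 t.
- by rewrite gtr0_norm// gtr0_sg//; exact: h.
- rewrite ltr0_norm// ltr0_sg// => t1.
  have Nt0 : 0 < - t by rewrite oppr_gt0.
  rewrite (_ : (fun n => iter n _ t) = - (fun n => iter n sharpen (- t))).
    by apply: cvgN; exact: h.
  by apply/funext => n; rewrite fctE iter_sharpenN opprK.
- move=> _; rewrite sgr0.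
  rewrite (_ : (fun n => _) = cst 0); first exact: cvg_cst.
  by apply/funext => n; rewrite iter_sharpen0.
Qed.

End sign_iteration.

(** * Trigonometric polynomials determine the Borel sets *)

Section uniqueness.
Context (R : realType).
Import Normc.

Lemma exp_horner_scale_sum (p : {poly R[i]}) (c z : R[i]) (k : int) : z != 0 ->
  z ^ k * p.[c * z] = \sum_(j < size p) (p`_j * c ^+ j) * z ^ (j%:Z + k).
Proof.
move=> z0; rewrite horner_coef mulr_sumr; apply: eq_bigr => j _.
by rewrite expfzDr// exprMn -exprnP; ring.
Qed.

(** Real-valued trigonometric polynomials. Factoring out the negative frequencies as [z^-k] leaves
    an ordinary polynomial, so sums and products reduce to those of [{poly R[i]}]. *)
Definition trigpoly (u : borel_circle R -> R) := exists k (p : {poly R[i]}),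
  forall z : circle R, (u z)%:C = circle_val z ^- k * p.[circle_val z].

Lemma trigpoly_cst (r : R) : trigpoly (fun=> r).
Proof. by exists 0%N, (r%:C%:P) => z; rewrite expr0 invr1 mul1r hornerC. Qed.

Lemma trigpolyM u v : trigpoly u -> trigpoly v -> trigpoly (fun z => u z * v z).
Proof.
move=> [k [p up]] [l [q vq]]; exists (k + l)%N, (p * q) => z.
by rewrite rmorphM/= up vq hornerM exprD invfM; ring.
Qed.

Lemma trigpolyD u v : trigpoly u -> trigpoly v -> trigpoly (fun z => u z + v z).
Proof.
move=> [k [p up]] [l [q vq]]; exists (k + l)%N, (p * 'X^l + q * 'X^k) => z.
rewrite rmorphD/= up vq !hornerE exprD invfM.
have := circle_val_neq0 z; move: (circle_val z) => t t0.
by field; rewrite !expf_neq0.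
Qed.

Lemma trigpoly_iter_sharpen u n : trigpoly u ->
  trigpoly (fun z => iter n (@sharpen R) (u z)).
Proof.
move=> tu; elim: n => //= n tn.
rewrite (_ : (fun z => _) = (fun z => 3 / 2 * iter n (@sharpen R) (u z) +
  (- 2^-1) * (iter n (@sharpen R) (u z) *
    (iter n (@sharpen R) (u z) * iter n (@sharpen R) (u z))))); last first.
  by apply/funext => z; rewrite /sharpen; field.
apply: trigpolyD; first by apply: trigpolyM => //; exact: trigpoly_cst.
apply: trigpolyM; first exact: trigpoly_cst.
by do 2 apply: trigpolyM => //.
Qed.

(* [r^2 - |z - c|^2 = z^-1 (r^2 z - (z - c) (1 - c^* z))] on the circle *)
Lemma trigpoly_ball (c : R[i]) (r : R) :
  trigpoly (fun z => r - normc (circle_val z - c) ^+ 2).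
Proof.
exists 1%N, (r%:C *: 'X - ('X - c%:P) * (1 - c^* *: 'X)) => z.
rewrite expr1 !hornerE.
have zV := circle_valV z; have z0 := circle_val_neq0 z.
rewrite rmorphB rmorphXn [X in _ - X ^+ 2](_ : _ = `|circle_val z - c|)//.
rewrite sqr_normc rmorphB/= -zV.
by field.
Qed.

Lemma trigpolyE (u : borel_circle R -> R) : trigpoly u ->
  exists k n (a : nat -> R[i]), (fun z => (u z)%:C) =
    (fun z => \sum_(i < n) a i * circle_val z ^ (i%:Z + k)).
Proof.
move=> [k [p up]]; exists (- k%:Z), (size p), (fun i => p`_i * 1 ^+ i).
apply/funext => z; rewrite -exp_horner_scale_sum ?circle_val_neq0//.
by rewrite up mul1r exprnN.
Qed.

Lemma trigpoly_bounded_measurable (u : borel_circle R -> R) :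
  trigpoly u -> bounded_measurable u.
Proof.
move=> /trigpolyE[k [n [a ua]]].
have [] : cbounded_measurable (fun z => (u z)%:C); last by [].
rewrite ua; apply: (cbounded_measurable_sum _ _
  (f := fun i (z : borel_circle R) => circle_val z ^ (i%:Z + k))) => i.
exact: cbounded_measurable_circle_exp.
Qed.

Context (mu : complex_measure (borel_circle R) R).

Lemma complex_integral_trigpoly (u : borel_circle R -> R) :
  (forall n, fourier_coef mu n = 0) -> trigpoly u ->
  complex_integral mu (fun z => (u z)%:C) = 0.
Proof.
move=> mu0 /trigpolyE[k [n [a ->]]].
rewrite (complex_integral_sum _ _ _
  (f := fun i (z : borel_circle R) => circle_val z ^ (i%:Z + k))) => [|i].
  rewrite big1// => i _; have := mu0 (- (i%:Z + k)); rewrite /fourier_coef.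
  by rewrite opprK => ->; rewrite mulr0.
exact: cbounded_measurable_circle_exp.
Qed.

(** The uniform bound serves both dominated convergence and stability under products, which makes
    this class a pi-system. *)
Definition trigpoly_approx (A : set (borel_circle R)) :=
  exists u_ : nat -> borel_circle R -> R,
    [/\ forall n, trigpoly (u_ n), forall n z, `|u_ n z| <= 1 &
        forall z, u_ ^~ z @ \oo --> (\1_A z : R)].

Lemma trigpoly_approxI : setI_closed trigpoly_approx.
Proof.
move=> A B [u [tu u1 uA]] [v [tv v1 vB]].
exists (fun n z => u n z * v n z); split => [n|n z|z].
- exact: trigpolyM.
- by rewrite normrM mulr_ile1.
- by rewrite indicI; apply: cvgM.
Qed.

(** The indicator of [A] is a pointwise limit of measurable functions, and [A] is its preimage of
    1. *)
Lemma trigpoly_approx_measurable A : trigpoly_approx A -> measurable A.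
Proof.
move=> [u [tu u1 uA]].
have mA : measurable_fun setT (\1_A : borel_circle R -> R).
  apply: (@measurable_fun_cvg _ _ _ _ u) => // m.
  by have [] := trigpoly_bounded_measurable (tu m).
have := mA measurableT [set 1] (measurable_set1 _).
rewrite setTI; congr measurable; apply/seteqP; split => z /=.
  rewrite indicE; case: (boolP (z \in A)) => [/set_mem//|_ /eqP].
  by rewrite eq_sym oner_eq0.
by move=> Az; rewrite indicE mem_set.
Qed.

Lemma complex_measure_trigpoly_approx A : (forall n, fourier_coef mu n = 0) ->
  trigpoly_approx A -> mu A = 0.
Proof.
move=> mu0 tA; rewrite -complex_integral_indic;
  last exact: trigpoly_approx_measurable.
have [u [tu u1 uA]] := tA.
apply: (@complex_integral_real_cvg0 _ _ _ _ u _ 1) => // n.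
- by have [] := trigpoly_bounded_measurable (tu n).
- exact: complex_integral_trigpoly.
Qed.

(** With [s] the iterated [sharpen] of [u], the functions [(s^2 + s) / 2] are trigonometric
    polynomials. Their limit sends the signs 1, 0, -1 to 1, 0, 0. *)
Lemma trigpoly_approx_pos (u : borel_circle R -> R) : trigpoly u ->
  (forall z, `|u z| <= 1) -> trigpoly_approx [set z | 0 < u z].
Proof.
move=> tu u1; pose s n z := iter n (@sharpen R) (u z).
have s1 n z : `|s n z| <= 1 by exact: iter_sharpen_le1.
exists (fun n z => 2^-1 * (s n z * s n z + s n z)); split => [n|n z|z].
- apply: trigpolyM; first exact: trigpoly_cst.
  have ts := trigpoly_iter_sharpen n tu.
  by apply: trigpolyD => //; exact: trigpolyM.
- rewrite normrM ger0_norm// ler_pdivrMl// mulr1 (le_trans (ler_normD _ _))//.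
  by rewrite -[leRHS]/(1 + 1 : R) lerD// normrM mulr_ile1.
- have su : s ^~ z @ \oo --> Num.sg (u z) by exact: iter_sharpen_cvg.
  have -> : (\1_[set z | 0 < u z] z : R) =
      2^-1 * (Num.sg (u z) * Num.sg (u z) + Num.sg (u z)).
    rewrite indicE; have [uz|uz|uz] := ltrgtP (u z) 0.
    + by rewrite memNset/= ?ltr0_sg//; [ring|apply/negP; rewrite -leNgt ltW].
    + by rewrite mem_set//= gtr0_sg// mulr1n; field.
    + by rewrite uz sgr0 memNset/= ?uz ?ltxx//; ring.
  by apply: cvgM; [exact: cvg_cst|apply: cvgD => //; exact: cvgM].
Qed.

Lemma trigpoly_approx_ball (c : R[i]) (r : R) : 0 <= r ->
  trigpoly_approx [set z | normc (circle_val z - c) < r].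
Proof.
(* [M] dominates [r^2 + |z - c|^2] on the circle, so dividing by it brings the function into
   [-1, 1], where the iteration converges. *)
move=> r0; pose M := 1 + r ^+ 2 + (1 + normc c) ^+ 2.
have M0 : 0 < M by rewrite /M -addrA ltr_pwDl// addr_ge0 ?sqr_ge0.
rewrite (_ : [set _ | _] =
    [set z | 0 < M^-1 * (r ^+ 2 - normc (circle_val z - c) ^+ 2)]).
  apply: trigpoly_approx_pos.
    by apply: trigpolyM; [exact: trigpoly_cst|exact: trigpoly_ball].
  move=> z; rewrite normrM gtr0_norm ?invr_gt0// mulrC ler_pdivrMr// mul1r.
  rewrite (le_trans (ler_normB _ _))// !ger0_norm ?sqr_ge0// /M lerD//.
    by rewrite lerDr.
  rewrite lerXn2r ?nnegrE ?normc_ge0 ?addr_ge0 ?normc_ge0//.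
  by rewrite (le_trans (normcB _ _))// normc_circle.
apply/seteqP; split => z /=.
  move=> zr; rewrite mulr_gt0 ?invr_gt0// subr_gt0.
  by rewrite ltrXn2r ?nnegrE ?normc_ge0.
rewrite pmulr_rgt0 ?invr_gt0// subr_gt0 => h.
by rewrite -(@ltr_pXn2r _ 2) ?nnegrE ?normc_ge0.
Qed.

(** Every open set is a countable union of traces of discs with rational centres in the plane, not
    necessarily on the circle, and radii [1 / (n + 1)]. *)
Lemma borel_circleE :
  (measurable : set (set (borel_circle R))) = <<s trigpoly_approx >>.
Proof.
apply/seteqP; split; last first.
  apply: smallest_sub; first exact: sigma_algebra_measurable.
  exact: trigpoly_approx_measurable.
apply: smallest_sub; first exact: smallest_sigma_algebra.
move=> U oU.
pose B (i : rat * rat * nat) : set (circle R) :=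
  [set z | normc (circle_val z - (ratr i.1.1 +i* ratr i.1.2)) < i.2.+1%:R^-1].
pose F i := if `[< B i `<=` U >] then B i else set0.
have -> : U = \bigcup_i F i.
  apply/seteqP; split => z.
    move=> Uz; have [e e0 eU] := circle_open_ball oU Uz.
    have e20 : 0 < e / 2 by rewrite divr_gt0.
    have [n _ /(_ n (leqnn n)) en] := near_infty_natSinv_lt (PosNum e20).
    rewrite /= in en.
    have d0 : 0 < n.+1%:R^-1 / 2 :> R by rewrite divr_gt0// invr_gt0.
    (* Moving each coordinate by less than half the radius keeps [z] in the disc. Any other point of
       the disc is then within [2 / (n + 1) < e] of [z]. *)
    have near_rat (x : R) : exists q, ratr q \in `]x, (x + n.+1%:R^-1 / 2)[.
      by apply: rat_in_itvoo; rewrite ltrDl.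
    have [a] := near_rat (complex.Re (circle_val z)).
    have [b] := near_rat (complex.Im (circle_val z)).
    rewrite !in_itv/= => /andP[b1 b2] /andP[a1 a2].
    have Bz : B (a, b, n) z.
      rewrite /B/= (le_lt_trans (normc_le_ReIm _))//.
      case: (circle_val z) a1 a2 b1 b2 => x y /= a1 a2 b1 b2.
      rewrite !ltr0_norm ?subr_lt0//.
      by move: (ratr a) (ratr b) (n.+1%:R^-1) a2 b2 => a' b' r a2 b2; lra.
    exists (a, b, n) => //; rewrite /F asboolT// => t Bt; apply: eU.
    rewrite [ltLHS](_ : _ = normc ((circle_val z - (ratr a +i* ratr b)) -
      (circle_val t - (ratr a +i* ratr b)))); last by congr normc; ring.
    rewrite (le_lt_trans (normcB _ _))//.
    by rewrite [ltRHS]splitr; apply: ltrD; exact: lt_trans en.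
  by move=> [i _]; rewrite /F; case: asboolP => // + Bz; apply.
apply: (@countable_bigcupT_measurable _ (g_sigma_algebraType trigpoly_approx)).
  exact: countableP.
move=> i; rewrite /F; case: asboolP => // _.
apply: sub_sigma_algebra; apply: trigpoly_approx_ball.
by rewrite invr_ge0.
Qed.

(** Dynkin's theorem: the sets of measure 0 contain the generating pi-system and are stable under
    countable disjoint unions. They are stable under complements because the whole circle also has
    measure 0. *)
Lemma fourier_coef_uniqueness A : (forall n, fourier_coef mu n = 0) ->
  measurable A -> mu A = 0.
Proof.
move=> mu0.
have mT : mu setT = 0.
  apply: complex_measure_trigpoly_approx => //.
  exists (fun _ _ => 1); split => [n|n z|z].
  - exact: trigpoly_cst.
  - by rewrite normr1.
  - by rewrite indicT; exact: cvg_cst.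
have mC (B : set (borel_circle R)) : measurable B -> mu B = 0 -> mu (~` B) = 0.
  move=> mB B0; rewrite -complex_integral_indic; last exact: measurableC.
  rewrite (_ : (fun x => _) = (fun x => (\1_setT x)%:C + -1 * (\1_B x)%:C)).
    have bI (X : set (borel_circle R)) (mX : measurable X) :=
      @cbounded_measurable_real _ _ R _ (bounded_measurable_indic R mX).
    have bN := cbounded_measurableM (cbounded_measurable_cst _ (-1)) (bI B mB).
    rewrite (complex_integralD _ (bI _ measurableT) bN).
    rewrite complex_integralZ; last exact: bI.
    by rewrite !complex_integral_indic// mT B0 mulr0 addr0.
  apply/funext => x; rewrite indicT indicC indicE mulN1r -raddfB/=.
  by congr (_%:C); case: (x \in B); rewrite ?subrr ?subr0.
rewrite borel_circleE.
apply: (@dynkin_induction _ (borel_circle R) trigpoly_approx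
  (fun A => mu A = 0)) => //.
- exact: borel_circleE.
- exact: trigpoly_approxI.
- by move=> B; exact: complex_measure_trigpoly_approx.
- move=> F mF tF F0.
  have := @complex_measureP _ _ _ mu F mF tF.
  under eq_fun do rewrite big1//.
  move=> h; apply: (cvg_unique _ h); first exact: norm_hausdorff.
  exact: cvg_cst.
Qed.

End uniqueness.

(** * Measures vanishing on an open set *)

Section main_estimate.
Context (R : realType) (mu : complex_measure (borel_circle R) R).
Import Normc.

(** The partition of [U] into [A], [U] minus [A] and empty sets competes in the supremum defining
    the variation, so [|mu A|] is at most the variation of [U]. *)
Lemma not_in_support (z : circle R) : ~ measure_support mu z ->
  exists U : set (circle R), [/\ open U, U z &
    forall A : set (borel_circle R), measurable A -> A `<=` U -> mu A = 0].
Proof.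
move=> /existsNP[U /not_implyP[oU /not_implyP[Uz]]].
move=> /negP; rewrite -leNgt => vU; exists U; split => // A mA AU.
have mU : measurable (U : set (borel_circle R)) by exact: sub_sigma_algebra.
have mD : measurable ((U `\` A) : set (borel_circle R)) by exact: measurableD.
apply: (@eq0_normc R); apply/eqP; rewrite eq_le normc_ge0 andbT -lee_fin.
apply: le_trans vU; pose F := bigcup2 A (U `\` A).
apply: (@le_trans _ _ (\sum_(0 <= i <oo) (normc (mu (F i)))%:E)%E).
  rewrite (@nneseriesD1 _ _ 0%N)//= => [|i _];
    last by rewrite lee_fin normc_ge0.
  by rewrite leeDl// nneseries_ge0// => i _ _; rewrite lee_fin normc_ge0.
apply: ereal_sup_ubound; exists F; split => //.
- move=> [|[|i]]; rewrite /F /bigcup2/=.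
  + exact: mA.
  + exact: mD.
  + exact: measurable0.
- by rewrite /F -trivIset_bigcup2 setDIK.
- by rewrite bigcup2E setDUK.
Qed.

Lemma fourier_coef_weight (w : nat -> R) (n : int) :
  (forall n, 0 < w n) ->
  (\esum_(n in [set: int])
      (normc (fourier_coef mu n) ^+ 2 * w `|n|%N)%:E < +oo)%E ->
  normc (fourier_coef mu n) ^+ 2 * w `|n|%N <=
  fine (\esum_(n in [set: int]) (normc (fourier_coef mu n) ^+ 2 * w `|n|%N)%:E).
Proof.
move=> w0 wS.
have t0 k : (0 <= (normc (fourier_coef mu k) ^+ 2 * w `|k|%N)%:E)%E.
  by rewrite lee_fin mulr_ge0 ?sqr_ge0// ltW.
rewrite -lee_fin fineK; last by rewrite ge0_fin_numE// esum_ge0.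
apply: esum_ge; exists [set n]; last by rewrite fsbig_set1.
by split => //; exact: finite_set1.
Qed.

Lemma complex_integral_exp_horner (p : {poly R[i]}) (c : R[i]) (m : int) :
  complex_integral mu (fun z => circle_val z ^ (- m) * p.[c * circle_val z]) =
  \sum_(j < size p) (p`_j * c ^+ j) * fourier_coef mu (m - j%:Z).
Proof.
rewrite (_ : (fun z => _) = (fun z : borel_circle R =>
    \sum_(j < size p) (p`_j * c ^+ j) * circle_val z ^ (j%:Z - m))); last first.
  by apply/funext => z; rewrite exp_horner_scale_sum// circle_val_neq0.
rewrite (complex_integral_sum mu _ (fun j => p`_j * c ^+ j)
  (f := fun j (z : borel_circle R) => circle_val z ^ (j%:Z - m))) => [|j].
  by apply: eq_bigr => j _; rewrite /fourier_coef opprB.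
exact: cbounded_measurable_circle_exp.
Qed.

(* Since [P`_0 = 1] and [P`_j = 0] for [0 < j <= 2N], expanding
   [\int z^-m P(c z) dmu] leaves [fourier_coef mu m] plus coefficients of order
   between [N] and [N + size P]. *)
Lemma fourier_coef_peak_le (p : {poly R[i]}) (c : R[i]) (m : int) (N : nat)
    (B : R) :
  normc c = 1 -> 0 <= B -> (`|m| <= N)%N -> p`_0 = 1 ->
  (forall j, (0 < j <= N + N)%N -> p`_j = 0) ->
  (forall n : int, (N < `|n| <= N + size p)%N ->
    normc (fourier_coef mu n) <= B) ->
  normc (fourier_coef mu m) <=
  normc (complex_integral mu
    (fun z => circle_val z ^ (- m) * p.[c * circle_val z])) +
  B * \sum_(j < size p) normc p`_j.
Proof.
move=> c1 B0 mN p0 pN muB; rewrite complex_integral_exp_horner.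
have := size_coef0_eq1 p0.
case: (size p) muB => // s muB _.
rewrite big_ord_recl p0 expr0 mul1r mul1r subr0.
set X := \sum_(i < s) _.
rewrite -{1}[fourier_coef mu m](addrK X) (le_trans (normcB _ _))// lerD2l.
rewrite big_ord_recl mulrDr (le_trans (normc_sum _ _ _))// -[leLHS]add0r.
rewrite lerD ?mulr_ge0 ?normc_ge0// mulr_sumr ler_sum// => i _.
rewrite lift0 !normcM normcX c1 expr1n mulr1 mulrC.
have [iN|iN] := leqP i.+1 (N + N).
  by rewrite (pN i.+1)// normc0 !mulr0.
(* The degree here is [j + 1]. As it exceeds [2 N] and [|m| <= N], the frequency [m - (j + 1)] has
   modulus above [N] and at most [N + size p]. *)
have := ltn_ord i; move: (i : nat) iN => j jN js.
by rewrite ler_wpM2r ?normc_ge0// muB//; lia.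
Qed.

(** For large [k] the coefficient is at most [(K + sqrt S) / (k + 1)]: the [K] part bounds the
    integral, since [P k] is small off [U], and the [sqrt S] part bounds the other frequencies
    through the weight. *)
Lemma fourier_coef_peak_vanish (w : nat -> R) (N : nat -> nat)
    (P : nat -> {poly R[i]}) (U : set (circle R)) (z0 : circle R) (m : int) :
  (forall n, 0 < w n) -> (forall k, (k <= N k)%N) ->
  (forall k, [/\ (P k)`_0 = 1,
    forall j, (0 < j <= N k + N k)%N -> (P k)`_j = 0,
    forall z, normc z = 1 -> k.+1%:R^-1 <= normc (z - 1) ->
      normc (P k).[z] <= k.+1%:R^-1 &
    forall j, (N k < j <= N k + size (P k))%N ->
      (k.+1%:R * \sum_(i < size (P k)) normc (P k)`_i) ^+ 2 <= w j]) ->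
  (\esum_(n in [set: int])
      (normc (fourier_coef mu n) ^+ 2 * w `|n|%N)%:E < +oo)%E ->
  open U -> U z0 ->
  (forall A : set (borel_circle R), measurable A -> A `<=` U -> mu A = 0) ->
  fourier_coef mu m = 0.
Proof.
move=> w0 kN NP wS oU Uz0 mu0.
have [e e0 eU] := circle_open_ball oU Uz0.
have [K K0 KP] := complex_integral_le mu.
have := fun n => fourier_coef_weight n w0 wS.
set S := fine _ => mS.
have S0 : 0 <= S by rewrite (le_trans _ (mS 0))// mulr_ge0 ?sqr_ge0// ltW.
have mU : measurable (U : set (borel_circle R)) by exact: sub_sigma_algebra.
(* The rotation by [c] moves the peak of the polynomials from 1 to [z0]. *)
pose c := (circle_val z0)^-1.
have c1 : normc c = 1 by rewrite /c normcV normc_circle invr1.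
have main k : (`|m| <= k)%N -> k.+1%:R^-1 < e ->
    normc (fourier_coef mu m) <= (K + Num.sqrt S) * k.+1%:R^-1.
  move=> mk ke; have [P0 PN Ps Pw] := NP k.
  set B := \sum_(i < size (P k)) _ in Pw.
  have k0 : 0 < k.+1%:R :> R by [].
  have B0 : 0 < B.
    rewrite /B; have := size_coef0_eq1 P0.
    case: (size _) => // s _; rewrite big_ord_recl/= P0 normc1 ltr_pwDl//.
    by apply: sumr_ge0 => i _; exact: normc_ge0.
  have D0 : 0 < k.+1%:R * B by rewrite mulr_gt0.
  (* In the relevant range the weight is at least [((k + 1) B)^2] and each weighted term is at most
     [S], whence the coefficient bound [sqrt S / ((k + 1) B)]. *)
  rewrite mulrDl (le_trans (@fourier_coef_peak_le (P k) c m (N k)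
    (Num.sqrt S / (k.+1%:R * B)) c1 _ _ P0 PN _))//.
  - by rewrite divr_ge0 ?sqrtr_ge0// ltW.
  - by rewrite (leq_trans mk).
  - move=> n nN; rewrite ler_pdivlMr// -(@ler_pXn2r _ 2) ?nnegrE
      ?sqrtr_ge0 ?(mulr_ge0 (normc_ge0 _) (ltW D0))//.
    rewrite sqr_sqrtr// exprMn (le_trans _ (mS n))// ler_wpM2l ?sqr_ge0//.
    exact: Pw.
  rewrite lerD//; last by rewrite -/B invfM mulrA divfK ?gt_eqF.
  apply: (KP U) => //.
  - rewrite (_ : (fun z => _) = (fun z : borel_circle R =>
        \sum_(j < size (P k)) ((P k)`_j * c ^+ j) * circle_val z ^ (j%:Z - m))).
      apply: (cbounded_measurable_sum _ (fun j => (P k)`_j * c ^+ j)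
        (f := fun j (z : borel_circle R) => circle_val z ^ (j%:Z - m))) => j.
      exact: cbounded_measurable_circle_exp.
    by apply/funext => z; rewrite exp_horner_scale_sum// circle_val_neq0.
  - move=> z Uz; rewrite normcM normc_circle_exp mul1r.
    apply: Ps; first by rewrite normcM c1 mul1r normc_circle.
    (* Writing 1 as [c z0] gives [|c z - 1| = |z - z0|], which is at least [e] off [U]. *)
    rewrite -(mulVf (circle_val_neq0 z0)) -/c -mulrBr normcM c1 mul1r.
    rewrite -normcN opprB (le_trans (ltW ke))// leNgt.
    by apply/negP => /eU.
apply: (@eq0_normc R); apply/eqP; rewrite eq_le normc_ge0 andbT.
have KS0 : 0 <= K + Num.sqrt S by rewrite addr_ge0 ?sqrtr_ge0.
apply/ler_addgt0Pr => d d0; rewrite add0r.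
(* The added 1 keeps the denominator positive even if [K] and [S] are both 0. *)
have d0' : 0 < Num.min e (d / (K + Num.sqrt S + 1)).
  by rewrite lt_min e0 divr_gt0// ltr_wpDl.
have [n _ /(_ (maxn n `|m|) (leq_maxl _ _))] :=
  near_infty_natSinv_lt (PosNum d0').
rewrite /= lt_min => /andP[ne nd].
rewrite (le_trans (main (maxn n `|m|) (leq_maxr _ _) ne))//.
move: nd; rewrite ltr_pdivlMr ?ltr_wpDl// => nd; apply: le_trans (ltW nd).
by rewrite mulrC ler_wpM2l ?invr_ge0// lerDl.
Qed.

End main_estimate.

Theorem theorem2p2 (R : realType) :
  exists w : nat -> R,
    [/\ forall n : nat, 0 < w n,
        limn_einf (fun n : nat => (w n)%:E) = 0%E
      & forall mu : complex_measure (borel_circle R) R,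
          (exists2 A : set (borel_circle R), measurable A & mu A <> 0) ->
          (\esum_(n in [set: int])
              (Normc.normc (fourier_coef mu n) ^+ 2 * w `|n|%N)%:E < +oo)%E ->
          measure_support mu = [set: circle R]].
Proof.
have [w [N [P [w0 w_inf kN NP]]]] := sparse_weights R.
exists w; split => // mu [A mA muA] wS.
apply/seteqP; split => // z _; apply: contrapT => /not_in_support[U [oU Uz U0]].
apply: muA; apply: fourier_coef_uniqueness => // n.
exact: (fourier_coef_peak_vanish n w0 kN NP wS oU Uz U0).
Qed.
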